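(* Let $\mathrm{P}$ be a training set distribution of $(X,Y)$ on $\mathcal{X}\times\{0,1\}$ with $0<\mathrm{P}[Y=0]<1$, and let $g:\mathcal{X}\to\{0,1\}$ be a (measurable) classifier such that $g(X)$ and $Y$ are not independent under $\mathrm{P}$, i.e. $\mathrm{P}[g(X)=0\,|\,Y=0]\neq\mathrm{P}[g(X)=0\,|\,Y=1]$. Then the Adjusted Classify & Count estimator $$T_{g,\mathrm{P}}(\mathrm{Q})=\frac{\mathrm{Q}[g(X)=0]-\mathrm{P}[g(X)=0\,|\,Y=1]}{\mathrm{P}[g(X)=0\,|\,Y=0]-\mathrm{P}[g(X)=0\,|\,Y=1]}$$ is Fisher consistent in $\mathcal{Q}_{\mathrm{prior}}(\mathrm{P})$ for the prevalence of class 0, i.e. $T_{g,\mathrm{P}}(\mathrm{Q})=\mathrm{Q}[Y=0]$ for all $\mathrm{Q}\in\mathcal{Q}_{\mathrm{prior}}(\mathrm{P})$.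
   Context: Setting: $(X,Y)$ is a random vector with values in $\mathcal{X}\times\{0,1\}$, where $\mathcal{X}$ is a measurable space; $X$ is the feature vector and $Y$ the class. $\mathrm{P}$ is the training set distribution and $\mathrm{Q}$ a test set distribution of $(X,Y)$. Throughout, $0<\mathrm{P}[Y=0]<1$ and $0<\mathrm{Q}[Y=0]<1$. $\mathcal{Q}_{\mathrm{prior}}(\mathrm{P})$ (prior probability shift) is the set of all such probability measures $\mathrm{Q}$ with $\mathrm{Q}[X\in S\,|\,Y=i]=\mathrm{P}[X\in S\,|\,Y=i]$ for $i=0,1$ and all measurable $S\subset\mathcal{X}$. An estimator $T$ is Fisher consistent in a family $\mathcal{Q}$ of test set distributions for the prevalence of class 0 if $T(\mathrm{Q})=\mathrm{Q}[Y=0]$ for all $\mathrm{Q}\in\mathcal{Q}$. *)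

(* Defs.v *)
From HB Require Import structures.
From mathcomp Require Import all_boot all_order all_algebra.
From mathcomp Require Import all_classical all_reals all_analysis.

Set Implicit Arguments.
Unset Strict Implicit.
Unset Printing Implicit Defensive.

Import Order.TTheory GRing.Theory Num.Theory.

Local Open Scope classical_set_scope.
Local Open Scope ring_scope.

Section Probability.
Context d (Omega : measurableType d) (R : realType).
Implicit Type P : probability Omega R.

Definition prob P (A : set Omega) : R := fine (P A).

(* P[A | B]; only meaningful when P[B] > 0, since division by 0 yields 0 *)
Definition cond_prob P (A B : set Omega) : R := prob P (A `&` B) / prob P B.

Definition independent_rv P d1 d2 (T1 : measurableType d1)
    (T2 : measurableType d2) (U : Omega -> T1) (V : Omega -> T2) : Prop :=
  forall (A : set T1) (B : set T2), measurable A -> measurable B ->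
    prob P (U @^-1` A `&` V @^-1` B) = prob P (U @^-1` A) * prob P (V @^-1` B).

End Probability.

(* The sample space is T * bool, on which a probability is a joint distribution
   of (X, Y) and X, Y are the coordinates. The classes 0 and 1 are encoded by
   false and true. *)
Section Quantification.
Context d (T : measurableType d) (R : realType).

Definition feature (w : T * bool) : T := w.1.
Definition label (w : T * bool) : bool := w.2.

Definition class0 : bool := false.
Definition class1 : bool := true.

Definition label_eq (i : bool) : set (T * bool) := label @^-1` [set i].

Definition pred_eq (g : T -> bool) (i : bool) : set (T * bool) :=
  (g \o feature) @^-1` [set i].

Definition prevalence0 (Q : probability (T * bool)%type R) : R :=
  prob Q (label_eq class0).

Definition nontrivial_prevalence (Q : probability (T * bool)%type R) : Prop :=
  0 < prevalence0 Q < 1.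

Definition prior_shift (P : probability (T * bool)%type R) :
    set (probability (T * bool)%type R) :=
  [set Q | nontrivial_prevalence Q /\
    forall (i : bool) (S : set T), measurable S ->
      cond_prob Q (feature @^-1` S) (label_eq i) =
      cond_prob P (feature @^-1` S) (label_eq i)].

Definition Fisher_consistent
    (F : set (probability (T * bool)%type R))
    (E : probability (T * bool)%type R -> R) : Prop :=
  forall Q, F Q -> E Q = prevalence0 Q.

Definition adjusted_classify_count (g : T -> bool)
    (P Q : probability (T * bool)%type R) : R :=
  (prob Q (pred_eq g class0)
     - cond_prob P (pred_eq g class0) (label_eq class1)) /
  (cond_prob P (pred_eq g class0) (label_eq class0)
     - cond_prob P (pred_eq g class0) (label_eq class1)).

End Quantification.

Arguments feature {d T}.
Arguments label {d T}.
Arguments label_eq {d T}.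

(* Main.v *)
Require Import Defs.
From mathcomp Require Import all_boot all_order all_algebra.
From mathcomp Require Import all_classical all_reals all_analysis.
From mathcomp Require Import ring lra.

Import Order.TTheory GRing.Theory Num.Theory.

Local Open Scope classical_set_scope.
Local Open Scope ring_scope.

(** By the law of total probability, [Q[g(X)=0]] is the mixture of the two
    class-conditional probabilities with weights [Q[Y=0]] and [Q[Y=1]]. Prior
    shift replaces these conditional probabilities by those of [P], and solving
    the resulting linear equation for [Q[Y=0]] gives the estimator. The equation
    is solvable because binary variables whose conditional probabilities
    [P[g(X)=0 | Y=i]] agree are independent. *)

Section BinaryVariables.
Context {d : measure_display} {Omega : measurableType d} {R : realType}
  (P : probability Omega R).

Lemma prob0 : prob P set0 = 0.
Proof. by rewrite /prob measure0. Qed.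

Lemma probT : prob P setT = 1.
Proof. by rewrite /prob probability_setT. Qed.

Lemma measurable_preimage_bool (V : Omega -> bool) (B : set bool) :
  measurable_fun setT V -> measurable (V @^-1` B).
Proof. by move=> mV; rewrite -[_ @^-1` _]setTI; exact: mV. Qed.

Lemma prob_total_bool (V : Omega -> bool) (E : set Omega) :
  measurable_fun setT V -> measurable E ->
  prob P E = \sum_(j : bool) prob P (E `&` V @^-1` [set j]).
Proof.
move=> mV mE; rewrite big_bool /= /prob.
have mEV j : measurable (E `&` V @^-1` [set j]).
  by apply: measurableI => //; exact: measurable_preimage_bool.
rewrite -fineD ?fin_num_measure // -measureU //.
  congr (fine (P _)); apply/seteqP; split => [x Ex | x [] []//].
  by case Vx: (V x); [left | right]; split.
by apply/seteqP; split => // x [[_ /= ->] [_]].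
Qed.

(** In the total probability sum, only the atoms with [j] in [B] survive. Writing the selection as a
    0/1 coefficient keeps the formula linear in the atoms, for every [B] at once. *)
Lemma prob_preimage_bool (V : Omega -> bool) (E : set Omega) (B : set bool) :
  measurable_fun setT V -> measurable E ->
  prob P (E `&` V @^-1` B) =
    \sum_(j : bool) (j \in B)%:R * prob P (E `&` V @^-1` [set j]).
Proof.
move=> mV mE; rewrite (prob_total_bool V); last 2 first.
- exact: mV.
- by apply: measurableI => //; exact: measurable_preimage_bool.
apply: eq_bigr => j _; case: (boolP (j \in B)) => [|]; rewrite ?inE ?notin_setE.
  move=> Bj; rewrite mul1r; congr prob; apply/seteqP.
  by split => x /= => [[[]]|[Ex Vx]]//; rewrite Vx.
move=> nBj; rewrite mul0r -prob0; congr prob; apply/seteqP.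
by split => x //= [[_ BV] Vx]; apply: nBj; rewrite -Vx.
Qed.

(** Both sides of the product formula are bilinear in the indicators of [A] and [B], so the four
    atoms suffice. *)
Lemma independent_rv_bool (U V : Omega -> bool) :
  measurable_fun setT U -> measurable_fun setT V ->
  (forall i j, prob P (U @^-1` [set i] `&` V @^-1` [set j]) =
     prob P (U @^-1` [set i]) * prob P (V @^-1` [set j])) ->
  independent_rv P U V.
Proof.
move=> mU mV UV A B _ _.
rewrite prob_preimage_bool//; last exact: measurable_preimage_bool.
under eq_bigr => j _.
  rewrite setIC prob_preimage_bool//; last exact: measurable_preimage_bool.
  under eq_bigr => i _ do rewrite setIC UV.
  over.
(* Intersecting with the whole space lets the marginals expand over atoms too. *)
rewrite -[U @^-1` A]setTI -[V @^-1` B]setTI !prob_preimage_bool//.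
rewrite !big_bool /= !setTI; ring.
Qed.

Lemma eq_cond_prob_independent (U V : Omega -> bool) :
  measurable_fun setT U -> measurable_fun setT V ->
  0 < prob P (V @^-1` [set false]) < 1 ->
  cond_prob P (U @^-1` [set false]) (V @^-1` [set false]) =
    cond_prob P (U @^-1` [set false]) (V @^-1` [set true]) ->
  independent_rv P U V.
Proof.
move=> mU mV /andP[p0 p1].
have mU' i := measurable_preimage_bool _ [set i] mU.
have mV' j := measurable_preimage_bool _ [set j] mV.
have sV := prob_total_bool V setT mV measurableT.
have sU := prob_total_bool U setT mU measurableT.
rewrite probT !big_bool /= !setTI in sV sU.
have q0 : 0 < prob P (V @^-1` [set true]) by lra.
(* Both class probabilities are positive, so cross-multiplication is legitimate. *)
rewrite /cond_prob => /eqP; rewrite eqr_div; [move=> /eqP e|exact: lt0r_neq0..].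
have s0 := prob_total_bool V _ mV (mU' false).
have t0 := prob_total_bool U _ mU (mV' false).
have t1 := prob_total_bool U _ mU (mV' true).
rewrite !big_bool /= in s0 t0 t1.
rewrite ![V @^-1` _ `&` _]setIC in t0 t1.
(* With a = P[U=0, V=0] and b = P[U=0, V=1], [e] says a P[V=1] = b P[V=0]. Adding a P[V=0] gives a =
   P[U=0] P[V=0]; the marginal sums settle the other three atoms. *)
by apply: independent_rv_bool => // -[] []; nra.
Qed.

Lemma cond_probK (A B : set Omega) :
  prob P B != 0 -> cond_prob P A B * prob P B = prob P (A `&` B).
Proof. by move=> B0; rewrite /cond_prob divfK. Qed.

End BinaryVariables.

Theorem mainTheorem2 (d : measure_display) (T : measurableType d)
    (R : realType) (P : probability (T * bool)%type R) (g : T -> bool)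
    (P_nontrivial : nontrivial_prevalence P)
    (g_meas : measurable_fun setT g)
    (g_dep : ~ independent_rv P (g \o feature) label) :
  Fisher_consistent (prior_shift P) (adjusted_classify_count g P).
Proof.
have mY : measurable_fun setT (@label d T) by exact: measurable_snd.
have mg : measurable_fun setT (g \o @feature d T).
  by apply: measurableT_comp => //; exact: measurable_fst.
move=> Q [/andP[q0 q1] QP].
have mS : measurable (g @^-1` [set class0]) by exact: measurable_preimage_bool.
have Pne : cond_prob P (pred_eq g class0) (label_eq class0)
         - cond_prob P (pred_eq g class0) (label_eq class1) != 0.
  rewrite subr_eq0; apply/eqP => e; apply: g_dep.
  exact: eq_cond_prob_independent.
have sY := prob_total_bool Q label setT mY measurableT.
have sg := prob_total_bool Q label _ mY (measurable_preimage_bool _ [set class0] mg).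
rewrite probT !big_bool /= !setTI in sY sg.
rewrite /prevalence0 /label_eq /class0 in q0 q1.
have r0 : 0 < prob Q (label @^-1` [set true]) by lra.
(* Both classes have positive probability under [Q], so each joint term factors as conditional times
   class probability. *)
rewrite -!cond_probK ?gt_eqF// in sg.
(* The event g(X)=0 says that X lies in the preimage of 0 under [g], a measurable set to which prior
   shift applies. *)
have e1 := QP class1 _ mS; have e0 := QP class0 _ mS.
rewrite /adjusted_classify_count; apply: (canLR (mulfK Pne)).
rewrite /prevalence0 /pred_eq sg.
rewrite /label_eq /class0 /class1 -!comp_preimage in e0 e1 *.
rewrite e0 e1.
have -> : prob Q (label @^-1` [set true]) = 1 - prob Q (label @^-1` [set false]) by lra.
ring.
Qed.
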